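(* Let $\theta>0$. If $E\subseteq\mathbb{R}^2$ is an $F_{\mathfrak{h}}$-set with $\mathfrak{h}(x)=\dfrac{1}{\log^{\theta}(1/x)}$, then $\dim(E)\ge\frac12$, where $\dim$ denotes Hausdorff dimension.
   Context: Dimension functions: $\mathbb{H}$ is the set of functions $h:[0,\infty)\to[0,\infty)$ that are non-decreasing, right continuous, and satisfy $h(0)=0$. Here $\log^\theta(1/x)=(\log(1/x))^\theta$, and the formula for $\mathfrak{h}$ is understood for small $x>0$; $\mathfrak{h}$ denotes any element of $\mathbb{H}$ that equals $1/\log^\theta(1/x)$ for all sufficiently small $x>0$ (the measure $\mathcal{H}^{\mathfrak{h}}$ depends only on the values near $0$). Hausdorff measures: for $h\in\mathbb{H}$, $E\subseteq\mathbb{R}^2$ and $\delta>0$, $\mathcal{H}^h_\delta(E)=\inf\{\sum_i h(\operatorname{diam}(E_i)) : E\subseteq\bigcup_{i=1}^\infty E_i,\ \operatorname{diam}(E_i)<\delta\}$, and $\mathcal{H}^h(E)=\sup_{\delta>0}\mathcal{H}^h_\delta(E)$. Furstenberg sets: for $\mathfrak{h}\in\mathbb{H}$, a set $E\subseteq\mathbb{R}^2$ is an $F_{\mathfrak{h}}$-set if for each direction $e$ in the unit circle $\mathbb{S}$ there is a line segment $\ell_e$ in the direction of $e$ such that $\mathcal{H}^{\mathfrak{h}}(\ell_e\cap E)>0$. *)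

(* Defs.v *)
From HB Require Import structures.
From mathcomp Require Import all_boot all_order all_algebra.
From mathcomp Require Import all_classical all_reals all_analysis.

Set Implicit Arguments.
Unset Strict Implicit.
Unset Printing Implicit Defensive.

Import Order.TTheory GRing.Theory Num.Theory.
Import numFieldNormedType.Exports.

Local Open Scope classical_set_scope.
Local Open Scope ring_scope.

(* The plane is [R * R]. Its library norm is the sup norm, so the Euclidean
   distance is written out. *)
Definition edist (R : realType) (p q : R * R) : R :=
  Num.sqrt ((p.1 - q.1) ^+ 2 + (p.2 - q.2) ^+ 2).

(* The [maxe 0] only matters for the empty set, whose diameter is then 0. *)
Definition diam (R : realType) (A : set (R * R)) : \bar R :=
  maxe 0%E (ereal_sup [set (edist p q)%:E | p in A & q in A]).

(* The class of dimension functions on [0, +oo[; values at negative arguments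
   are irrelevant. *)
Definition dimension_function (R : realType) (h : R -> R) : Prop :=
  [/\ h 0 = 0,
      forall x, 0 <= x -> 0 <= h x,
      forall x y, 0 <= x -> x <= y -> h x <= h y
    & forall x, 0 <= x -> h y @[y --> x^'+] --> h x].

(* [diam (A i) < delta%:E] makes the diameters finite, so [fine] loses
   nothing. *)
Definition hausdorff_content (R : realType) (h : R -> R) (delta : R)
    (E : set (R * R)) : \bar R :=
  ereal_inf [set (\sum_(0 <= i <oo) (h (fine (diam (A i))))%:E)%E | A in
    [set A : nat -> set (R * R) |
      E `<=` \bigcup_i A i /\ forall i, (diam (A i) < delta%:E)%E]].

Definition hausdorff_measure (R : realType) (h : R -> R)
    (E : set (R * R)) : \bar R :=
  ereal_sup [set hausdorff_content h delta E | delta in [set d : R | 0 < d]].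

(* Restricting to [s > 0] keeps [x `^ s] a dimension function ([0 `^ 0 = 1])
   and does not change the infimum. *)
Definition hausdorff_dim (R : realType) (E : set (R * R)) : \bar R :=
  ereal_inf [set s%:E | s in
    [set s : R | 0 < s /\ hausdorff_measure (fun x => x `^ s) E = 0%E]].

Definition unit_circle (R : realType) : set (R * R) :=
  [set e | e.1 ^+ 2 + e.2 ^+ 2 = 1].

Definition segment (R : realType) (a e : R * R) (L : R) : set (R * R) :=
  [set (a.1 + t * e.1, a.2 + t * e.2) | t in [set t : R | 0 <= t <= L]].

Definition furstenberg_set (R : realType) (h : R -> R) (E : set (R * R)) :
    Prop :=
  forall e, unit_circle e ->
    exists (a : R * R) (L : R),
      0 < L /\ (0 < hausdorff_measure h (segment a e L `&` E))%E.

(* Main.v *)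
Require Import Defs.
From mathcomp Require Import all_boot all_order all_algebra.
From mathcomp Require Import all_classical all_reals all_analysis.
From mathcomp Require Import ring lra.

(** Suppose [E] had dimension below 1/2, so that [H^s(E) = 0] for some
    [0 < s < 1/2], and consider the directions of slope [m] in [0, 1].

    Cover [E] by sets [A_i] with [d_i = diam A_i < r_0] and [sum_i d_i ^ s]
    small, and sort the indices into blocks: [i] is in block [j] when
    [r_{j+1} < d_i <= r_j].  Two points of a line of slope [m], one in [A_i],
    the other in [A_k], determine [m] up to an error of order
    [max d_i d_k / |gap|], where the gap is the horizontal distance of the two
    points ([joining_slopes_close]).  If both indices are in block [j] and the
    gap is at least of order [x_j = r_j ^ e], the error is of order
    [r_j ^ (1 - e)].  The scales decrease superexponentially,
    [r_{j+1} = r_j ^ (1 + e)], and [e = (1 - 2 s) / (1 + 2 s)] is chosen so that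
    [1 - e = 2 s (1 + e)]; hence the error is of order
    [r_{j+1} ^ (2 s) <= d_i ^ s * d_k ^ s]
    ([separated_joining_slopes]).  Summed over all pairs this gives
    [(sum_i d_i ^ s) ^ 2], so the slopes obtained in this way, over all pairs
    and all blocks, have arbitrarily small Lebesgue measure
    ([joining_slopes_cover]).

    For any other slope [m], the part of [E] which lies on a line of slope [m]
    and in the sets of block [j] has diameter at most [x_j].  It therefore
    costs at most [h x_j], and because [ln (1 / x_j)] is a multiple of
    [(1 + e) ^ j], these costs form a geometric series for every [theta > 0],
    arbitrarily small with [r_0] ([log_scales_summable]).  This is the reason
    for superexponential blocks: with dyadic ones the costs [j ^ (- theta)]
    would not be summable for [theta <= 1].  Thus [E] has [h]-content at most any
    prescribed [c] on the line ([content_le_blocks]).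

    Consequently the slopes of the lines that carry [h]-content more than [c]
    at scale [delta] form a null set ([rich_slopes_negligible]).  In an
    [h]-Furstenberg set every slope in [0, 1] is of this kind for some
    [c = delta = 1 / (n + 1)], which would make [0, 1] a null set. *)

Set Implicit Arguments.
Unset Strict Implicit.
Unset Printing Implicit Defensive.

Import Order.TTheory GRing.Theory Num.Theory.
Import numFieldNormedType.Exports.

Local Open Scope classical_set_scope.
Local Open Scope ring_scope.

(* Unqualified, the name would denote the extended-real distance of
   pseudometric spaces. *)
Local Notation edist := Defs.edist.

(** * Euclidean diameters *)

Section Diameter.
Context {R : realType}.
Implicit Types (A : set (R * R)) (p q : R * R) (r d : R).

Lemma edist_ge_fst p q : `|p.1 - q.1| <= edist p q.
Proof.
by rewrite -sqrtr_sqr ler_wsqrtr// lerDl sqr_ge0.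
Qed.

Lemma edist_ge_snd p q : `|p.2 - q.2| <= edist p q.
Proof.
by rewrite -sqrtr_sqr ler_wsqrtr// lerDr sqr_ge0.
Qed.

Lemma edist_le2 p q r : `|p.1 - q.1| <= r -> `|p.2 - q.2| <= r ->
  edist p q <= 2 * r.
Proof.
move=> h1 h2; have r0 : 0 <= r by exact: le_trans h1.
rewrite -[leRHS]ger0_norm ?mulr_ge0// -sqrtr_sqr ler_wsqrtr//.
have s1 : (p.1 - q.1) ^+ 2 <= r ^+ 2.
  by rewrite -[leLHS]real_normK ?num_real// lerXn2r ?nnegrE.
have s2 : (p.2 - q.2) ^+ 2 <= r ^+ 2.
  by rewrite -[leLHS]real_normK ?num_real// lerXn2r ?nnegrE.
nra.
Qed.

Lemma diam_ge0 A : (0 <= diam A)%E.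
Proof. by rewrite /diam le_max lexx. Qed.

Lemma edist_le_diam A p q : A p -> A q -> ((edist p q)%:E <= diam A)%E.
Proof.
move=> Ap Aq; rewrite /diam le_max; apply/orP; right.
by apply: ereal_sup_ubound; exists p => //; exists q.
Qed.

Lemma diam_le A r : 0 <= r -> (forall p q, A p -> A q -> edist p q <= r) ->
  (diam A <= r%:E)%E.
Proof.
move=> r0 Ar; rewrite /diam ge_max lee_fin r0/=.
by apply: ge_ereal_sup => _ [p Ap [q Aq <-]]; rewrite lee_fin Ar.
Qed.

Lemma diam_fineK A d : (diam A < d%:E)%E -> ((fine (diam A))%:E = diam A)%E.
Proof.
move=> Ad; rewrite fineK// ge0_fin_numE ?diam_ge0//.
exact: lt_trans (ltry d).
Qed.

End Diameter.

(** * Series of nonnegative terms *)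

Section Series.
Context {R : realType}.

Lemma nneseries_le_partial (u : nat -> R) (c : R) : (forall n, 0 <= u n) ->
  (forall N, \sum_(0 <= i < N) u i <= c) ->
  (\sum_(0 <= i <oo) (u i)%:E <= c%:E)%E.
Proof.
move=> u0 uc; apply: lime_le.
  by apply: is_cvg_nneseries => n _ _; rewrite lee_fin.
by apply: nearW => N; rewrite sumEFin lee_fin.
Qed.

(** Lets two sequences of sets be interleaved into one cover when the sets at
    the even places cost nothing. *)
Lemma sum_odd_le (u v : nat -> R) (c : R) : (forall n, 0 <= u n) ->
  (forall n, u n.*2 = 0) -> (forall n, u n.*2.+1 <= v n) ->
  (forall N, \sum_(0 <= i < N) v i <= c) ->
  forall N, \sum_(0 <= i < N) u i <= c.
Proof.
move=> u0 ue uo vc N; apply: le_trans (vc N).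
have : \sum_(0 <= i < N.*2) u i <= \sum_(0 <= i < N) v i.
  elim: N => [|N IH]; first by rewrite !big_nil.
  by rewrite doubleS !big_nat_recr//= ue addr0 lerD.
apply: le_trans; rewrite (@big_cat_nat _ _ _ N 0 N.*2)//=; last first.
  by rewrite -addnn leq_addr.
by rewrite lerDl sumr_ge0.
Qed.

Lemma geometric_sum_le (a q : R) N : 0 <= a -> 0 <= q < 1 ->
  \sum_(0 <= j < N) a * q ^+ j <= a / (1 - q).
Proof.
move=> a0 /andP[q0 q1].
have -> : \sum_(0 <= j < N) a * q ^+ j = a * (1 - q ^+ N) / (1 - q).
  elim: N => [|N IH]; first by rewrite big_nil expr0 subrr mulr0 mul0r.
  rewrite big_nat_recr//= IH exprS; field; lra.
rewrite ler_pM2r ?invr_gt0 ?subr_gt0// ler_piMr// lerBlDr lerDl.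
exact: exprn_ge0.
Qed.

End Series.

(** * Hausdorff contents *)

Section Content.
Context {R : realType}.
Implicit Types (h : R -> R) (E S : set (R * R)).

Lemma content_antimono h (d d' : R) E : d' <= d ->
  (hausdorff_content h d E <= hausdorff_content h d' E)%E.
Proof.
move=> dd; apply: le_ereal_inf_tmp => _ [A [EA Ad] <-].
apply: ereal_inf_lbound; exists A => //; split => // i.
by apply: lt_le_trans (Ad i) _; rewrite lee_fin.
Qed.

Lemma cover_of_null_measure h (d tau : R) E :
  hausdorff_measure h E = 0%E -> 0 < d -> 0 < tau ->
  exists A : nat -> set (R * R), [/\ E `<=` \bigcup_i A i,
    forall i, (diam (A i) < d%:E)%E &
    (\sum_(0 <= i <oo) (h (fine (diam (A i))))%:E <= tau%:E)%E].
Proof.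
move=> H0 d0 t0.
have : (hausdorff_content h d E < tau%:E)%E.
  apply: (@le_lt_trans _ _ 0%E); last by rewrite lte_fin.
  by rewrite -H0; apply: ereal_sup_ubound; exists d.
by move=> /ereal_inf_lt[_ [A [EA Ad] <-]] /ltW At; exists A; split.
Qed.

(** Each block of the cover [A] is replaced by the single set of points of [S]
    that it covers.  The sets of diameter 0 belong to no block and there may
    be infinitely many of them, but they cost nothing because [h 0 = 0]; so
    they are kept, at the even places of the new cover. *)
Lemma content_le_blocks h (r x : nat -> R) (delta c : R) S
    (A : nat -> set (R * R)) :
  dimension_function h -> 0 < delta ->
  (forall j, 0 <= x j < delta) ->
  (forall N, \sum_(0 <= j < N) h (x j) <= c) ->
  (forall d, 0 < d -> exists j, r j < d) ->
  S `<=` \bigcup_i A i -> (forall i, (diam (A i) < (r 0%N)%:E)%E) ->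
  (forall j i i' p q, r j.+1 < fine (diam (A i)) <= r j ->
    r j.+1 < fine (diam (A i')) <= r j -> A i p -> A i' q -> S p -> S q ->
    edist p q <= x j) ->
  (hausdorff_content h delta S <= c%:E)%E.
Proof.
move=> [h00 h0 hm _] delta0 xd hc r0 SA Ar Sx.
pose B k := if odd k then
    S `&` [set p | exists2 i, r k./2.+1 < fine (diam (A i)) <= r k./2 & A i p]
  else if diam (A k./2) == 0%E then A k./2 else set0.
have Beven k : diam (B k.*2) = 0%E.
  rewrite /B odd_double doubleK; case: eqP => // _.
  by apply/le_anti/andP; split; [apply: diam_le|exact: diam_ge0].
have Bodd k : (diam (B k.*2.+1) <= (x k)%:E)%E.
  apply: diam_le => [|p q]; first by case/andP: (xd k).
  rewrite /B/= odd_double/= uphalf_double => -[Sp [i ri Ap]] [Sq [i' ri' Aq]].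
  exact: Sx ri ri' Ap Aq Sp Sq.
have Blt k : (diam (B k) < delta%:E)%E.
  rewrite -(odd_double_half k); case: (odd k); rewrite ?add1n ?add0n.
    by apply: le_lt_trans (Bodd _) _; rewrite lte_fin; case/andP: (xd k./2).
  by rewrite Beven lte_fin.
have hB0 k : 0 <= h (fine (diam (B k))) by rewrite h0// fine_ge0// diam_ge0.
apply: (@le_trans _ _ (\sum_(0 <= k <oo) (h (fine (diam (B k))))%:E)%E).
  apply: ereal_inf_lbound; exists B => //; split => // p Sp.
  have [i _ Ap] := SA p Sp.
  have dE := diam_fineK (Ar i).
  have d0 : 0 <= fine (diam (A i)) by rewrite fine_ge0// diam_ge0.
  have [dz|dz] := eqVneq (fine (diam (A i))) 0.
    exists i.*2 => //; rewrite /B odd_double doubleK.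
    by rewrite -dE dz eqxx.
  have dgt : 0 < fine (diam (A i)) by rewrite lt_neqAle eq_sym dz.
  have ex := r0 _ dgt.
  (* The first scale below the diameter ends the block of [A i]. *)
  case: (ex_minnP ex) => j rj jmin.
  case: j rj jmin => [|j] rj jmin.
    by move: rj; rewrite ltNge -lee_fin dE (ltW (Ar i)).
  exists j.*2.+1 => //; rewrite /B/= odd_double/= uphalf_double; split => //.
  exists i => //; rewrite rj/= leNgt; apply/negP => /jmin.
  by rewrite ltnn.
apply: nneseries_le_partial => //.
apply: (sum_odd_le hB0 _ _ hc) => k.
  by rewrite Beven h00.
have /andP[x0 _] := xd k.
apply: hm; first by rewrite fine_ge0// diam_ge0.
by rewrite -lee_fin (diam_fineK (Blt _)).
Qed.
End Content.

(** * Slopes of lines joining two small sets *)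

Section Slopes.
Context {R : realType}.

Lemma negligible_small_cover (X : set R) :
  (forall eta : R, 0 < eta -> exists2 U : set R, measurable U /\ X `<=` U &
     (lebesgue_measure U <= eta%:E)%E) ->
  lebesgue_measure.-negligible X.
Proof.
move=> small.
have small_n n : exists U : set R, [/\ measurable U, X `<=` U &
    (lebesgue_measure U <= (n.+1%:R^-1)%:E)%E].
  have [|U [mU XU] Un] := small n.+1%:R^-1; first by rewrite invr_gt0.
  by exists U; split.
have [U UP] := choice small_n.
exists (\bigcap_n U n); split.
- by apply: bigcap_measurable => // n _; case: (UP n).
- apply/le_anti/andP; split; last exact: measure_ge0.
  apply/lee_addgt0Pr => e e0; rewrite add0e.
  have [n ne] : exists n, n.+1%:R^-1 < e.
    exists (Num.truncn e^-1); rewrite invf_plt ?posrE//.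
    exact: truncnS_gt.
  have [mU _ Un] := UP n.
  apply: (@le_trans _ _ (lebesgue_measure (U n))).
    apply: le_measure; rewrite ?inE//; last exact: bigcap_inf.
    by apply: bigcap_measurable => // k _; case: (UP k).
  by apply: le_trans Un _; rewrite lee_fin ltW.
- by move=> x Xx n _; case: (UP n) => _ + _; exact.
Qed.

(** The number [v] is the precision to which the two sets determine the slope:
    their diameters are at most a quarter of [v] times the horizontal gap. *)
Definition joining_slopes (A B : set (R * R)) (v : R) : set R :=
  [set m | 0 <= m <= 1 /\ exists p q : R * R, [/\ A p, B q,
     q.2 - p.2 = m * (q.1 - p.1), 0 < `|q.1 - p.1| &
     (maxe (diam A) (diam B) <= (v * `|q.1 - p.1| / 4)%:E)%E]].

(** Moving [p] within [A] and [q] within [B] changes each coordinate of [q - p]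
    by at most [v * d / 2], [d] being the gap for [m]; as [`|m0| <= 1], this
    bounds [`|m - m0| * d] by [v * d]. *)
Lemma joining_slopes_close A B v m m0 :
  joining_slopes A B v m -> joining_slopes A B v m0 -> `|m - m0| <= v.
Proof.
move=> [_ [p [q [Ap Bq hm d0 dv]]]] [/andP[m00 m01] [p0 [q0 [Ap0 Bq0 hm0 _ _]]]].
set d := `|q.1 - p.1| in d0 dv.
have /andP[Ad Bd] :
    (diam A <= (v * d / 4)%:E)%E && (diam B <= (v * d / 4)%:E)%E.
  by rewrite -ge_max.
have a : edist p p0 <= v * d / 4.
  by rewrite -lee_fin; apply: le_trans (edist_le_diam Ap Ap0) Ad.
have b : edist q q0 <= v * d / 4.
  by rewrite -lee_fin; apply: le_trans (edist_le_diam Bq Bq0) Bd.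
have a1 := le_trans (edist_ge_fst p p0) a.
have a2 := le_trans (edist_ge_snd p p0) a.
have b1 := le_trans (edist_ge_fst q q0) b.
have b2 := le_trans (edist_ge_snd q q0) b.
rewrite -(ler_pM2r d0) /d -normrM.
have -> : (m - m0) * (q.1 - p.1) = (q.2 - q0.2) - (p.2 - p0.2)
    - m0 * ((q.1 - q0.1) - (p.1 - p0.1)).
  move: hm hm0; lra.
have t : `|(q.1 - q0.1) - (p.1 - p0.1)| <= v * d / 2.
  by apply: le_trans (ler_normB _ _) _; lra.
apply: le_trans (ler_normB _ _) _.
have u : `|(q.2 - q0.2) - (p.2 - p0.2)| <= v * d / 2.
  by apply: le_trans (ler_normB _ _) _; lra.
have w : `|m0 * ((q.1 - q0.1) - (p.1 - p0.1))| <= v * d / 2.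
  by rewrite normrM ger0_norm//; apply: le_trans t; rewrite ler_piMl.
rewrite -/d; lra.
Qed.

Lemma joining_slopes_itv A B v : 0 <= v -> exists U : set R,
  [/\ measurable U, joining_slopes A B v `<=` U &
      (lebesgue_measure U <= (2 * v)%:E)%E].
Proof.
move=> v0.
have [[m0 Sm0]|/set0P/negP/negPn/eqP->] :=
    pselect (joining_slopes A B v !=set0); last first.
  by exists set0; split => //; rewrite measure0 lee_fin mulr_ge0.
exists `[m0 - v, m0 + v]%classic; split => //.
- move=> m Sm /=; rewrite in_itv/= -ler_distlC.
  by rewrite distrC; exact: joining_slopes_close Sm Sm0.
- rewrite lebesgue_measure_itv/= lte_fin -EFinB.
  case: ifP => _; rewrite lee_fin; lra.
Qed.

(** The product form [w i * w k] of the precisions turns the total length into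
    the square of a single sum. *)
Lemma joining_slopes_cover (A : nat -> set (R * R)) (w : nat -> R) (tau : R) :
  (forall i, 0 <= w i) -> (\sum_(0 <= i <oo) (w i)%:E <= tau%:E)%E ->
  exists U : set R, [/\ measurable U,
    forall i k, joining_slopes (A i) (A k) (w i * w k) `<=` U &
    (lebesgue_measure U <= (2 * tau ^+ 2)%:E)%E].
Proof.
move=> w0 wt.
have t0 : 0 <= tau.
  rewrite -lee_fin; apply: le_trans wt.
  by apply: nneseries_ge0 => n _ _; rewrite lee_fin.
have one (ik : nat * nat) : exists U : set R, [/\ measurable U,
    joining_slopes (A ik.1) (A ik.2) (w ik.1 * w ik.2) `<=` U &
    (lebesgue_measure U <= (2 * (w ik.1 * w ik.2))%:E)%E].
  by apply: joining_slopes_itv; rewrite mulr_ge0.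
have [U UP] := choice one.
have mU i k : measurable (U (i, k)) by case: (UP (i, k)).
have mUi i : measurable (\bigcup_k U (i, k)) by exact: bigcup_measurable.
have mUU : measurable (\bigcup_i \bigcup_k U (i, k)) by exact: bigcup_measurable.
exists (\bigcup_i \bigcup_k U (i, k)); split => //.
  move=> i k m Sm; exists i => //; exists k => //.
  by case: (UP (i, k)) => _ + _; exact.
have scale (a : R) : 0 <= a ->
    (\sum_(0 <= k <oo) (a * w k)%:E <= (a * tau)%:E)%E.
  move=> a0; under eq_eseriesr do rewrite EFinM.
  rewrite nneseriesZl; last by move=> k _; rewrite lee_fin.
  by rewrite EFinM lee_wpmul2l.
apply: le_trans (measure_sigma_subadditive lebesgue_measure mUi mUU
  (@subset_refl _ _)) _.
have -> : 2 * tau ^+ 2 = (2 * tau) * tau by ring.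
apply: le_trans (scale (2 * tau) _); last by rewrite mulr_ge0.
apply: lee_nneseries => [i _ _|i _]; first exact: measure_ge0.
apply: le_trans (measure_sigma_subadditive lebesgue_measure (mU i) (mUi i)
  (@subset_refl _ _)) _.
have -> : 2 * tau * w i = (2 * w i) * tau by ring.
apply: le_trans (scale (2 * w i) _); last by rewrite mulr_ge0.
apply: lee_nneseries => [k _ _|k _]; first exact: measure_ge0.
by case: (UP (i, k)) => _ _; rewrite mulrA.
Qed.

End Slopes.

(** * Superexponential scales *)

Section Scales.
Context {R : realType}.

Lemma expR_superexp_small (M l d : R) : 0 < M -> 1 < l -> 0 < d ->
  exists j, expR (- (M * l ^+ j)) < d.
Proof.
move=> M0 l1 d0; set e := l - 1.
have e0 : 0 < e by rewrite subr_gt0.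
have bern j : 1 + e * j%:R <= l ^+ j.
  elim: j => [|j IH]; first by rewrite mulr0 addr0.
  have sq : 0 <= j%:R * e * e by rewrite !mulr_ge0// ltW.
  have : l * (1 + e * j%:R) <= l ^+ j.+1.
    by rewrite exprS ler_wpM2l// ltW// (lt_trans _ l1).
  apply: le_trans; have -> : l = 1 + e by rewrite /e; ring.
  rewrite -natr1; lra.
have [j] : exists j : nat, `|ln d| / (M * e) < j%:R.
  by exists (Num.truncn (`|ln d| / (M * e))).+1; exact: truncnS_gt.
rewrite ltr_pdivrMr ?mulr_gt0// => jl; exists j.
rewrite -ltr_ln// ?posrE ?expR_gt0// expRK.
have nl : - ln d <= `|ln d| by rewrite -normrN ler_norm.
have : M * (1 + e * j%:R) <= M * l ^+ j by rewrite ler_pM2l.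
by lra.
Qed.

(** At the argument [expR (- (M * l ^+ j))] the function [h] takes the value
    [M `^ (- theta) * (l `^ (- theta)) ^+ j], a geometric sequence whose
    sum tends to 0 as [M] grows. *)
Lemma log_scales_summable (h : R -> R) (theta l delta c : R) :
  0 < theta -> 1 < l -> 0 < delta -> 0 < c ->
  (\forall x \near 0^'+, h x = 1 / (ln (1 / x) `^ theta)) ->
  exists2 M : R, 0 < M & (forall j, expR (- (M * l ^+ j)) < delta) /\
    (forall N, \sum_(0 <= j < N) h (expR (- (M * l ^+ j))) <= c).
Proof.
move=> th0 l1 delta0 c0 /nbhs_ballP[e /= e0 he].
set q := (l `^ theta)^-1.
have lth : 1 < l `^ theta.
  have one : 1 `^ theta = 1 :> R by rewrite powR1.
  by rewrite -one gt0_ltr_powR// nnegrE ltW// (lt_trans _ l1).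
have q0 : 0 < q by rewrite invr_gt0 (lt_trans _ lth).
have q1 : q < 1 by rewrite invf_lt1// (lt_trans _ lth).
have cq0 : 0 < c * (1 - q) by rewrite mulr_gt0// subr_gt0.
set d := Num.min e delta.
have d0 : 0 < d by rewrite lt_min e0.
(* The first term bounds the sum by [c]; the second brings the scales below
   [d <= e], where the formula for [h] holds. *)
set M := (c * (1 - q))^-1 `^ theta^-1 + `|ln d| + 1.
have M1 : 1 <= M by rewrite lerDr addr_ge0// powR_ge0.
have M0 : 0 < M by exact: lt_le_trans M1.
have lj j : 1 <= l ^+ j by rewrite exprn_ege1// ltW.
have small j : expR (- (M * l ^+ j)) < d.
  rewrite -ltr_ln ?posrE ?expR_gt0// expRK.
  have nl : - ln d <= `|ln d| by rewrite -normrN ler_norm.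
  have lnM : `|ln d| < M.
    by rewrite /M -addrA addrCA ltrDl ltr_wpDl ?powR_ge0.
  have : M * 1 <= M * l ^+ j by rewrite ler_pM2l.
  by lra.
exists M => //; split => [j|N].
  by apply: lt_le_trans (small j) _; rewrite ge_min lexx orbT.
have hj j : h (expR (- (M * l ^+ j))) = (M `^ theta)^-1 * q ^+ j.
  rewrite he/=; [|rewrite /ball/= sub0r normrN gtr0_norm ?expR_gt0//|
    exact: expR_gt0]; last first.
    by apply: lt_le_trans (small j) _; rewrite ge_min lexx.
  have l0 : 0 <= l by rewrite ltW// (lt_trans _ l1).
  have M0' := ltW M0.
  have lp : (l ^+ j) `^ theta = (l `^ theta) ^+ j.
    by rewrite -(powR_mulrn j l0) powRAC powR_mulrn ?powR_ge0.
  rewrite !div1r -expRN opprK expRK powRM ?exprn_ge0// invfM; congr (_ * _).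
  by rewrite /q exprVn lp.
under eq_bigr do rewrite hj.
apply: le_trans (geometric_sum_le _ _ _) _; rewrite ?invr_ge0 ?powR_ge0//.
rewrite ler_pdivrMr ?subr_gt0// -[leRHS]invrK lef_pV2 ?posrE ?powR_gt0 ?invr_gt0//.
have -> : (c * (1 - q))^-1 = ((c * (1 - q))^-1 `^ theta^-1) `^ theta.
  by rewrite -powRrM mulVf ?gt_eqF// powRr1 ?invr_ge0 ?(ltW cq0).
rewrite ge0_ler_powR ?nnegrE ?powR_ge0 ?(ltW th0) ?(ltW M0)//.
by rewrite /M -addrA lerDl addr_ge0.
Qed.
End Scales.

(** * Lines of large content *)

Section RichSlopes.
Context {R : realType}.
Implicit Types (h : R -> R) (E S : set (R * R)).

(** A part of a line is given as a set of points which pairwise span the slope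
    [m], so that no base point and length have to be carried along. *)
Definition rich_slopes h E (delta c : R) : set R :=
  [set m | 0 <= m <= 1 /\ exists2 S, S `<=` E /\
     (forall p q, S p -> S q -> q.2 - p.2 = m * (q.1 - p.1)) &
     (c%:E < hausdorff_content h delta S)%E].

(** With [r = expR (- a)] and [x = r ^ e], a gap above [x / 2] gives
    [16 * (dA * dB) ^ s * gap / 4 >= 2 * r ^ (2 * s * (1 + e) + e) = 2 * r],
    which exceeds both diameters.  The factors 4 absorb the constants lost in
    passing from the distance to the gap. *)
Lemma separated_joining_slopes (A B : set (R * R)) (s e a m dA dB : R) p q :
  0 < s -> 2 * s * (1 + e) + e = 1 -> 0 <= m <= 1 ->
  q.2 - p.2 = m * (q.1 - p.1) ->
  diam A = dA%:E -> diam B = dB%:E ->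
  expR (- (a * (1 + e))) < dA <= expR (- a) ->
  expR (- (a * (1 + e))) < dB <= expR (- a) ->
  A p -> B q -> expR (- (e * a)) < edist p q ->
  joining_slopes A B ((4 * dA `^ s) * (4 * dB `^ s)) m.
Proof.
move=> s0 se m01 hm EA EB /andP[A1 A2] /andP[B1 B2] Ap Bq pq.
split=> //; exists p, q.
have /andP[m0 m1] := m01.
set d := `|q.1 - p.1|.
have dpos : expR (- (e * a)) < 2 * d.
  apply: lt_le_trans pq _; apply: edist_le2; first by rewrite distrC.
  by rewrite distrC hm normrM ger0_norm// ler_piMl.
have x0 := expR_gt0 (- (e * a)).
have w_ge D : expR (- (a * (1 + e))) < D ->
    expR (- (s * (a * (1 + e)))) <= D `^ s.
  move=> hD; rewrite -mulrN mulrC expRM.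
  rewrite ge0_ler_powR ?nnegrE ?expR_ge0 ?(ltW s0) ?(ltW hD)//.
  by rewrite ltW// (lt_trans _ hD)// expR_gt0.
have key : expR (- a) <= (4 * dA `^ s) * (4 * dB `^ s) * d / 4.
  set y := expR (- (s * (a * (1 + e)))).
  have -> : expR (- a) = y * y * expR (- (e * a)).
    rewrite -!expRD; congr expR.
    have -> : - a = - (a * (2 * s * (1 + e) + e)) by rewrite se mulr1.
    ring.
  have yA : y <= dA `^ s by exact: w_ge.
  have yB : y <= dB `^ s by exact: w_ge.
  have y0 : 0 < y by exact: expR_gt0.
  have yy : y * y <= dA `^ s * dB `^ s by rewrite ler_pM// ltW.
  have -> : (4 * dA `^ s) * (4 * dB `^ s) * d / 4 =
    (dA `^ s * dB `^ s) * (4 * d) by field.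
  by apply: ler_pM; [rewrite mulr_ge0// ltW|exact: ltW|exact: yy|lra].
split=> //; first by rewrite -/d; lra.
by rewrite EA EB ge_max !lee_fin (le_trans A2 key) (le_trans B2 key).
Qed.

(** For a fixed block sequence, covers of [E] with ever smaller [s]-sums put the
    rich slopes into sets of ever smaller measure. *)
Lemma rich_slopes_negligible h (theta s delta c : R) E :
  0 < theta -> dimension_function h ->
  (\forall x \near 0^'+, h x = 1 / (ln (1 / x) `^ theta)) ->
  0 < s < 1 / 2 -> hausdorff_measure (fun x => x `^ s) E = 0%E ->
  0 < delta -> 0 < c ->
  lebesgue_measure.-negligible (rich_slopes h E delta c).
Proof.
move=> th0 hH hlog /andP[s0 s12] HE0 delta0 c0.
set e := (1 - 2 * s) / (1 + 2 * s).
have e0 : 0 < e by rewrite divr_gt0; lra.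
have se : 2 * s * (1 + e) + e = 1 by rewrite /e; field; lra.
have l1 : 1 < 1 + e by lra.
have [M M0 [xdelta xsum]] := log_scales_summable th0 l1 delta0 c0 hlog.
set x := fun j : nat => expR (- (M * (1 + e) ^+ j)).
set a := fun j : nat => M / e * (1 + e) ^+ j.
set r := fun j : nat => expR (- a j).
have aS j : a j.+1 = a j * (1 + e) by rewrite /a exprSr mulrA.
have xE j : x j = expR (- (e * a j)).
  by rewrite /x /a !mulrA [e * M]mulrC mulfK ?gt_eqF.
apply: negligible_small_cover => eta eta0.
(* The exceptional slopes will have measure at most [2 * (4 * tau) ^+ 2]. *)
set tau := Num.min 1 (eta / 32).
have t0 : 0 < tau by rewrite lt_min ltr01 divr_gt0.
have [A [EA Ad At]] := cover_of_null_measure HE0 (expR_gt0 (- a 0%N)) t0.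
pose d i := fine (diam (A i)).
have dE i : diam (A i) = (d i)%:E by rewrite (diam_fineK (Ad i)).
pose w i := 4 * d i `^ s.
have w0 i : 0 <= w i by rewrite mulr_ge0// powR_ge0.
have wt : (\sum_(0 <= i <oo) (w i)%:E <= (4 * tau)%:E)%E.
  under eq_eseriesr do rewrite EFinM.
  rewrite nneseriesZl; last by move=> k _; rewrite lee_fin powR_ge0.
  by rewrite EFinM lee_wpmul2l.
have [U [mU JU Ut]] := joining_slopes_cover A w0 wt.
exists U; last first.
  apply: le_trans Ut _; rewrite lee_fin.
  have t1 : tau <= 1 by rewrite ge_min lexx.
  have t2 : tau <= eta / 32 by rewrite ge_min lexx orbT.
  have : tau * tau <= 1 * tau by rewrite ler_pM2r.
  rewrite exprMn (expr2 tau); lra.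
split => // m [m01 [S [SE Sm] cS]].
apply: contrapT => nUm; move: cS; apply/negP; rewrite -leNgt.
apply: (@content_le_blocks _ h r x _ _ S A) => //.
- by move=> j; rewrite expR_ge0 xdelta.
- by move=> D D0; apply: expR_superexp_small => //; rewrite divr_gt0.
- exact: subset_trans SE EA.
- move=> j i k p q ri rk Ap Aq Sp Sq.
  rewrite leNgt; apply/negP; rewrite xE => pq; apply: nUm.
  apply: (JU i k); rewrite /r aS in ri rk.
  exact: (separated_joining_slopes s0 se m01 (Sm _ _ Sp Sq) (dE i) (dE k)
    ri rk Ap Aq pq).
Qed.

Lemma slope_mem_rich h E (m : R) : furstenberg_set h E -> 0 <= m <= 1 ->
  exists n : nat, rich_slopes h E n.+1%:R^-1 n.+1%:R^-1 m.
Proof.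
move=> hE m01.
set u := Num.sqrt (1 + m ^+ 2).
have u2 : u ^+ 2 = 1 + m ^+ 2 by rewrite sqr_sqrtr// addr_ge0// sqr_ge0.
have u0 : 0 < u by rewrite sqrtr_gt0; have := sqr_ge0 m; lra.
have [|a [L [_ /ereal_sup_gt[_ [delta d0 <-] cpos]]]] := hE (1 / u, m / u).
  rewrite /unit_circle/= !expr_div_n expr1n u2 -mulrDl divff//.
  by rewrite -u2 expf_neq0// gt_eqF.
have [c c0 cc] : exists2 c : R, 0 < c & (c%:E <
    hausdorff_content h delta (segment a ((1 / u)%R, (m / u)%R) L `&` E))%E.
  move: cpos; case: (hausdorff_content _ _ _) => [t|_|//].
    by rewrite lte_fin => t0; exists (t / 2); rewrite ?lte_fin; lra.
  by exists 1 => //; rewrite ltry.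
have [n /andP[nd nc]] : exists n : nat, (n.+1%:R^-1 < delta) && (n.+1%:R^-1 < c).
  exists (Num.truncn (Num.min delta c)^-1).
  by rewrite -lt_min invf_plt ?posrE ?lt_min ?d0//; exact: truncnS_gt.
exists n; split => //.
exists (segment a (1 / u, m / u) L `&` E).
  split; first by move=> p [].
  move=> p q [[t _ <-] _] [[t' _ <-] _] /=; field; exact: lt0r_neq0.
apply: lt_le_trans (content_antimono _ _ (ltW nd)).
by apply: lt_trans cc; rewrite lte_fin.
Qed.

End RichSlopes.

Theorem corollary5p2 (R : realType) (theta : R) (h : R -> R)
    (E : set (R * R)) (theta_gt0 : 0 < theta) (hH : dimension_function h)
    (h_log : \forall x \near 0^'+, h x = 1 / (ln (1 / x) `^ theta))
    (hE : furstenberg_set h E) :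
  ((1 / 2)%:E <= hausdorff_dim E)%E.
Proof.
apply: le_ereal_inf_tmp => _ [s [s0 Hs] <-]; rewrite lee_fin leNgt.
apply/negP => s12.
have rich_null : lebesgue_measure.-negligible
    (\bigcup_n rich_slopes h E n.+1%:R^-1 n.+1%:R^-1).
  apply: negligible_bigcup => n.
  apply: (rich_slopes_negligible theta_gt0 hH h_log _ Hs); rewrite ?invr_gt0//.
  by rewrite s0.
have cover : `[0, 1]%classic `<=`
    \bigcup_n rich_slopes h E n.+1%:R^-1 n.+1%:R^-1.
  move=> m; rewrite /= in_itv/= => m01.
  by have [n mn] := slope_mem_rich hE m01; exists n.
have [N [mN N0 richN]] := rich_null.
have : (lebesgue_measure (`[0%R, 1%R]%classic : set R) <= lebesgue_measure N)%E.
  by apply: le_measure; rewrite ?inE//; exact: subset_trans richN.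
by rewrite N0 lebesgue_measure_itv/= lte_fin ltr01 -EFinB subr0 lee_fin ler10.
Qed.
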